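(* Let $\{(x^k,y^k)\}$ be the sequence generated by Algorithm 1 (described in the context) for solving $$F^\star=\min_{(x,y)}\{F(z)=f(x)+g(y)\;:\;Ax+By-c\in\mathcal K\},$$ with $z^k:=(x^k,y^k)$. Let $z^\star=(x^\star,y^\star)\in\mathcal Z^\star$ and $\lambda^\star\in\Lambda^\star$. Then, for all $k\ge 1$, $$\big|F(z^k)-F^\star\big|\le \frac{\max\{\rho_0R_p^2,\;2\|\lambda^\star\|R_d\}}{2\rho_0k},\qquad \mathrm{dist}_{\mathcal K}\big(Ax^k+By^k-c\big)\le\frac{R_d}{\rho_0k},$$ where $R_p^2:=\gamma_0\|x^0-x^\star\|^2+\rho_0\|B\|^2\|y^0-y^\star\|^2$ and $R_d:=\|\lambda^\star\|+\sqrt{\|\lambda^\star\|^2+\rho_0R_p^2}$. Consequently, the (non-ergodic, i.e. last-iterate) convergence rate of Algorithm 1 is $O(1/k)$: $|F(z^k)-F^\star|\le O(1/k)$ and $\mathrm{dist}_{\mathcal K}(Ax^k+By^k-c)\le O(1/k)$.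
   Context: Setting. $f:\mathbb R^{p_1}\to\mathbb R\cup\{+\infty\}$ and $g:\mathbb R^{p_2}\to\mathbb R\cup\{+\infty\}$ are proper, closed, convex; $A\in\mathbb R^{n\times p_1}$, $B\in\mathbb R^{n\times p_2}$ with $B\ne0$, $c\in\mathbb R^n$; $\mathcal K\subseteq\mathbb R^n$ is nonempty, closed, convex. $\|\cdot\|$ is the Euclidean norm for vectors and the induced operator norm for matrices. $z=(x,y)$, $F(z):=f(x)+g(y)$, $\mathrm{dom}(F)=\mathrm{dom}(f)\times\mathrm{dom}(g)$, and $F^\star$ is the optimal value of minimizing $F(z)$ subject to $Ax+By-c\in\mathcal K$. Lagrange function: $\mathcal L(x,y,r,\lambda):=f(x)+g(y)-\langle Ax+By-r-c,\lambda\rangle$ with $r\in\mathcal K$. A point $(x^\star,y^\star,r^\star,\lambda^\star)\in\mathrm{dom}(f)\times\mathrm{dom}(g)\times\mathcal K\times\mathbb R^n$ is a saddle point if $\mathcal L(x^\star,y^\star,r^\star,\lambda)\le\mathcal L(x^\star,y^\star,r^\star,\lambda^\star)\le\mathcal L(x,y,r,\lambda^\star)$ for all $(x,y)\in\mathrm{dom}(F)$, $r\in\mathcal K$, $\lambda\in\mathbb R^n$. $\mathcal Z^\star$ is the set of $(x^\star,y^\star)$-components and $\Lambda^\star$ the set of $\lambda^\star$-components of saddle points. Standing assumption: the set of saddle points is nonempty, and $F^\star$ is finite and attained at some $(x^\star,y^\star)\in\mathcal Z^\star$. $\mathrm{dist}_{\mathcal K}$ and $\mathrm{proj}_{\mathcal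 K}$ are the Euclidean distance to and projection onto $\mathcal K$. $\psi(x,y):=\frac12\mathrm{dist}_{\mathcal K}(Ax+By-c)^2$, and $\nabla_y\psi(x,y)=B^\top\big(Ax+By-c-\mathrm{proj}_{\mathcal K}(Ax+By-c)\big)$. For $\gamma>0$, $\mathrm{prox}_{\gamma g}(v):=\arg\min_u\{g(u)+\frac1{2\gamma}\|u-v\|^2\}$. Algorithm 1. Choose $(x^0,y^0)\in\mathrm{dom}(F)$, $\rho_0>0$, $\gamma_0\ge0$; set $\hat x^0:=x^0$, $\hat y^0:=y^0$. For $k=0,1,2,\dots$: - $x^{k+1}\in\arg\min_x\{f(x)+\rho_k\psi(x,\hat y^k)+\frac{\gamma_k}2\|x-\hat x^k\|^2\}$ (this set is assumed nonempty; any element may be taken); - $y^{k+1}:=\mathrm{prox}_{g/(\rho_k\|B\|^2)}\big(\hat y^k-\frac1{\|B\|^2}\nabla_y\psi(x^{k+1},\hat y^k)\big)$; - $(\hat x^{k+1},\hat y^{k+1}):=(x^{k+1},y^{k+1})+\frac{k}{k+2}(x^{k+1}-x^k,\,y^{k+1}-y^k)$; - $\rho_{k+1}:=(k+2)\rho_0$, $\gamma_{k+1}:=\gamma_0(k+2)$. *)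

(* Defs.v *)
(* Vectors of R^p are columns 'cV[R]_p, extended-valued
   functions are valued in \bar R.  The norm `|v| that the library puts on
   matrices is the max norm, so the Euclidean norm and the operator norm
   induced by it are defined here; the topology on 'cV[R]_p is the usual one. *)
From HB Require Import structures.
From mathcomp Require Import all_boot all_order all_algebra.
From mathcomp Require Import all_classical all_reals all_analysis.

Set Implicit Arguments.
Unset Strict Implicit.
Unset Printing Implicit Defensive.

Import Order.TTheory GRing.Theory Num.Theory.
Import numFieldNormedType.Exports.

Local Open Scope classical_set_scope.
Local Open Scope ring_scope.

Definition dotv (R : realType) (p : nat) (u v : 'cV[R]_p) : R :=
  \sum_(i < p) u i 0 * v i 0.

Definition norm2 (R : realType) (p : nat) (v : 'cV[R]_p) : R :=
  Num.sqrt (dotv v v).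

Definition opnorm (R : realType) (m p : nat) (M : 'M[R]_(m, p)) : R :=
  sup [set norm2 (M *m v) | v in [set v : 'cV[R]_p | norm2 v <= 1]].

Definition dom (R : realType) (T : Type) (h : T -> \bar R) : set T :=
  [set u | (h u < +oo)%E].

Definition proper_fun (R : realType) (T : Type) (h : T -> \bar R) : Prop :=
  (forall u, h u != -oo%E) /\ dom h !=set0.

Definition epigraph (R : realType) (T : Type) (h : T -> \bar R) : set (T * R) :=
  [set ur | (h ur.1 <= ur.2%:E)%E].

Definition closed_fun (R : realType) (p : nat) (h : 'cV[R]_p -> \bar R) : Prop :=
  closed (epigraph h).

(* At t = 0 and t = 1 this uses the convention 0 * +oo = 0. *)
Definition convex_fun (R : realType) (p : nat) (h : 'cV[R]_p -> \bar R) : Prop :=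
  forall (u v : 'cV[R]_p) (t : R), 0 <= t <= 1 ->
    (h (t *: u + (1 - t) *: v)%R <= t%:E * h u + (1 - t)%:E * h v)%E.

Definition argmin (R : realType) (T : Type) (h : T -> \bar R) : set T :=
  [set u | forall v, (h u <= h v)%E].

(* xget 0 S is an element of S, and 0 if S is empty; for h proper, closed,
   convex and gamma > 0 the set of minimizers is a singleton. *)
Definition prox (R : realType) (p : nat) (gamma : R) (h : 'cV[R]_p -> \bar R)
    (v : 'cV[R]_p) : 'cV[R]_p :=
  xget 0 (argmin (fun u => h u + ((2 * gamma)^-1 * norm2 (u - v) ^+ 2)%:E)%E).

Definition dist_set (R : realType) (n : nat) (K : set 'cV[R]_n) (s : 'cV[R]_n) : R :=
  inf [set norm2 (s - w) | w in K].

(* For K nonempty, closed and convex the set below is a singleton. *)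
Definition proj_set (R : realType) (n : nat) (K : set 'cV[R]_n) (s : 'cV[R]_n)
    : 'cV[R]_n :=
  xget 0 [set w | K w /\ forall v, K v -> norm2 (s - w) <= norm2 (s - v)].

Definition objective (R : realType) (p1 p2 : nat) (f : 'cV[R]_p1 -> \bar R)
    (g : 'cV[R]_p2 -> \bar R) (z : 'cV[R]_p1 * 'cV[R]_p2) : \bar R :=
  (f z.1 + g z.2)%E.

Definition cstr (R : realType) (n p1 p2 : nat) (A : 'M[R]_(n, p1))
    (B : 'M[R]_(n, p2)) (c : 'cV[R]_n) (z : 'cV[R]_p1 * 'cV[R]_p2) : 'cV[R]_n :=
  A *m z.1 + B *m z.2 - c.

Definition feasible (R : realType) (n p1 p2 : nat) (A : 'M[R]_(n, p1))
    (B : 'M[R]_(n, p2)) (c : 'cV[R]_n) (K : set 'cV[R]_n)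
    : set ('cV[R]_p1 * 'cV[R]_p2) :=
  [set z | K (cstr A B c z)].

Definition optval (R : realType) (n p1 p2 : nat) (f : 'cV[R]_p1 -> \bar R)
    (g : 'cV[R]_p2 -> \bar R) (A : 'M[R]_(n, p1)) (B : 'M[R]_(n, p2))
    (c : 'cV[R]_n) (K : set 'cV[R]_n) : \bar R :=
  ereal_inf [set objective f g z | z in feasible A B c K].

Definition lagrangian (R : realType) (n p1 p2 : nat) (f : 'cV[R]_p1 -> \bar R)
    (g : 'cV[R]_p2 -> \bar R) (A : 'M[R]_(n, p1)) (B : 'M[R]_(n, p2))
    (c : 'cV[R]_n) (x : 'cV[R]_p1) (y : 'cV[R]_p2) (r lam : 'cV[R]_n) : \bar R :=
  (f x + g y - (dotv (A *m x + B *m y - r - c)%R lam)%:E)%E.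

Definition saddle_point (R : realType) (n p1 p2 : nat) (f : 'cV[R]_p1 -> \bar R)
    (g : 'cV[R]_p2 -> \bar R) (A : 'M[R]_(n, p1)) (B : 'M[R]_(n, p2))
    (c : 'cV[R]_n) (K : set 'cV[R]_n)
    (xs : 'cV[R]_p1) (ys : 'cV[R]_p2) (rs lams : 'cV[R]_n) : Prop :=
  [/\ dom f xs, dom g ys, K rs &
    forall x y r lam, dom f x -> dom g y -> K r ->
      (lagrangian f g A B c xs ys rs lam <= lagrangian f g A B c xs ys rs lams)%E /\
      (lagrangian f g A B c xs ys rs lams <= lagrangian f g A B c x y r lams)%E].

Definition Zstar (R : realType) (n p1 p2 : nat) (f : 'cV[R]_p1 -> \bar R)
    (g : 'cV[R]_p2 -> \bar R) (A : 'M[R]_(n, p1)) (B : 'M[R]_(n, p2))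
    (c : 'cV[R]_n) (K : set 'cV[R]_n) : set ('cV[R]_p1 * 'cV[R]_p2) :=
  [set z | exists r lam, saddle_point f g A B c K z.1 z.2 r lam].

Definition Lambdastar (R : realType) (n p1 p2 : nat) (f : 'cV[R]_p1 -> \bar R)
    (g : 'cV[R]_p2 -> \bar R) (A : 'M[R]_(n, p1)) (B : 'M[R]_(n, p2))
    (c : 'cV[R]_n) (K : set 'cV[R]_n) : set 'cV[R]_n :=
  [set lam | exists x y r, saddle_point f g A B c K x y r lam].

Definition psi (R : realType) (n p1 p2 : nat) (A : 'M[R]_(n, p1))
    (B : 'M[R]_(n, p2)) (c : 'cV[R]_n) (K : set 'cV[R]_n)
    (x : 'cV[R]_p1) (y : 'cV[R]_p2) : R :=
  2^-1 * dist_set K (cstr A B c (x, y)) ^+ 2.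

(* The closed form of the gradient of psi x at y. *)
Definition grad_y_psi (R : realType) (n p1 p2 : nat) (A : 'M[R]_(n, p1))
    (B : 'M[R]_(n, p2)) (c : 'cV[R]_n) (K : set 'cV[R]_n)
    (x : 'cV[R]_p1) (y : 'cV[R]_p2) : 'cV[R]_p2 :=
  B^T *m (cstr A B c (x, y) - proj_set K (cstr A B c (x, y))).

(* (x, y, xh, yh, rho, gamma) is a run of the method started at (x 0, y 0) with
   parameters rho 0 and gamma 0; the choice of x k.+1 among the minimizers is
   free, so a run is a relation and not a function of the starting data. *)
Record algorithm1 (R : realType) (n p1 p2 : nat) (f : 'cV[R]_p1 -> \bar R)
    (g : 'cV[R]_p2 -> \bar R) (A : 'M[R]_(n, p1)) (B : 'M[R]_(n, p2))
    (c : 'cV[R]_n) (K : set 'cV[R]_n)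
    (x : nat -> 'cV[R]_p1) (y : nat -> 'cV[R]_p2)
    (xh : nat -> 'cV[R]_p1) (yh : nat -> 'cV[R]_p2)
    (rho gamma : nat -> R) : Prop := Algorithm1 {
  alg_x0 : dom f (x 0%N);
  alg_y0 : dom g (y 0%N);
  alg_rho0 : 0 < rho 0%N;
  alg_gamma0 : 0 <= gamma 0%N;
  alg_xh0 : xh 0%N = x 0%N;
  alg_yh0 : yh 0%N = y 0%N;
  alg_x : forall k, argmin (fun u =>
    f u + (rho k * psi A B c K u (yh k)
           + gamma k / 2 * norm2 (u - xh k) ^+ 2)%:E)%E (x k.+1);
  alg_y : forall k, y k.+1 =
    prox (rho k * opnorm B ^+ 2)^-1 g
      (yh k - (opnorm B ^+ 2)^-1 *: grad_y_psi A B c K (x k.+1) (yh k));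
  alg_xh : forall k, xh k.+1 =
    x k.+1 + (k%:R / (k + 2)%:R) *: (x k.+1 - x k);
  alg_yh : forall k, yh k.+1 =
    y k.+1 + (k%:R / (k + 2)%:R) *: (y k.+1 - y k);
  alg_rho : forall k, rho k.+1 = (k + 2)%:R * rho 0%N;
  alg_gamma : forall k, gamma k.+1 = gamma 0%N * (k + 2)%:R
}.

(* Rp2 is the quantity R_p^2, not R_p itself. *)
Definition Rp2 (R : realType) (n p1 p2 : nat) (B : 'M[R]_(n, p2))
    (rho0 gamma0 : R) (x0 xs : 'cV[R]_p1) (y0 ys : 'cV[R]_p2) : R :=
  gamma0 * norm2 (x0 - xs) ^+ 2 + rho0 * opnorm B ^+ 2 * norm2 (y0 - ys) ^+ 2.

Definition Rd (R : realType) (n : nat) (rho0 rp2 : R) (lam : 'cV[R]_n) : R :=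
  norm2 lam + Num.sqrt (norm2 lam ^+ 2 + rho0 * rp2).

(* Main.v *)
Require Import Defs.
From HB Require Import structures.
From mathcomp Require Import all_boot all_order all_algebra.
From mathcomp Require Import all_classical all_reals all_analysis.
From mathcomp Require Import ring lra.

Set Implicit Arguments.
Unset Strict Implicit.
Unset Printing Implicit Defensive.

Import Order.TTheory GRing.Theory Num.Theory.
Import numFieldNormedType.Exports.

Local Open Scope classical_set_scope.
Local Open Scope ring_scope.

(** Write s(z) = A x + B y - c, let q(z) = s(z) - proj s(z), so that |q(z)| is
    the distance of s(z) to K, and put L = |B|^2.  The rates follow from an
    energy that decreases along the run.  For a saddle point with primal part
    zs = (xs, ys) and one with multiplier lams, it is

      E_k = k (F(z^k) - Fmin) + k^2 rho0 dist(s(z^k))^2 / 2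
            + (gamma0 |a^k - xs|^2 + rho0 L |b^k - ys|^2) / 2,

    where (a^k, b^k) is the leading point for which (k + 1) zhat^k is
    k z^k + (a^k, b^k) and (k + 1) z^(k+1) is k z^k + (a^(k+1), b^(k+1)); the
    extrapolation weight k / (k + 2) is the one making both hold (lead_xh,
    lead_x).  Since a^0 = x^0 and b^0 = y^0, E_0 is half of R_p^2.

    For the decrease, each iteration compares z^(k+1) with an arbitrary z
    (alternating_step): the penalty dist^2 / 2 is convex with gradient q and
    lies below its quadratic model, so the x-step and the proximal y-step
    together give a bound by F(z), by the linearisation of the penalty at
    s = A x^(k+1) + B yhat^k - c, and by inner products.  This is used at z^k
    with weight k and at zs with weight 1.  The inner products then form a
    difference of squared distances (three_point), up to a term of favourable
    sign, and this difference is the change of the last part of E_k.  The growth of the penalty parameter between two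
    iterations seems to cost k rho0 |q(z^k)|^2 / 2; but the linearisation at s
    lies below the penalty at s' by at least |q - q'|^2 / 2 (sqr_dist_set_ge),
    and with the weights k and 1 these gains compensate the cost exactly, by
    completing a square (energy_arith, energy_decreasing).

    The saddle point of lams gives F(z) - Fmin >= - |lams| dist(s(z)).  Together with E_k <= E_0 it is a quadratic inequality in
    rho0 k dist(s(z^k)), whose larger root is R_d (rate_arith), and both rates
    follow.

    The y-step is defined by a chosen minimizer, so one has to know that the
    minimum is attained.  A closed convex function is bounded below on a ball by
    compactness, hence decreases at most linearly by convexity, and adding the
    proximal quadratic makes it coercive (convex_linear_minorant,
    prox_argmin). *)

(** * Euclidean geometry of column vectors *)

Lemma dotvC (R : realType) p (u v : 'cV[R]_p) : dotv u v = dotv v u.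
Proof. by apply: eq_bigr => i _; rewrite mulrC. Qed.

Lemma dotvDl (R : realType) p (u v w : 'cV[R]_p) :
  dotv (u + v) w = dotv u w + dotv v w.
Proof. by rewrite -big_split/=; apply: eq_bigr => i _; rewrite mxE mulrDl. Qed.

Lemma dotvDr (R : realType) p (u v w : 'cV[R]_p) :
  dotv w (u + v) = dotv w u + dotv w v.
Proof. by rewrite dotvC dotvDl !(dotvC w). Qed.

Lemma dotvZl (R : realType) p (a : R) (u v : 'cV[R]_p) :
  dotv (a *: u) v = a * dotv u v.
Proof. by rewrite /dotv mulr_sumr; apply: eq_bigr => i _; rewrite mxE mulrA. Qed.

Lemma dotvZr (R : realType) p (a : R) (u v : 'cV[R]_p) :
  dotv u (a *: v) = a * dotv u v.
Proof. by rewrite dotvC dotvZl dotvC. Qed.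

Lemma dotvNl (R : realType) p (u v : 'cV[R]_p) : dotv (- u) v = - dotv u v.
Proof. by rewrite -scaleN1r dotvZl mulN1r. Qed.

Lemma dotvNr (R : realType) p (u v : 'cV[R]_p) : dotv u (- v) = - dotv u v.
Proof. by rewrite dotvC dotvNl dotvC. Qed.

Lemma dot0v (R : realType) p (u : 'cV[R]_p) : dotv 0 u = 0.
Proof. by rewrite -(scale0r 0) dotvZl mul0r. Qed.

Definition dotvE := (dotvDl, dotvDr, dotvNl, dotvNr, dotvZl, dotvZr).

Lemma dotv_mulmx (R : realType) n p (M : 'M[R]_(n, p)) u v :
  dotv u (M *m v) = dotv (M^T *m u) v.
Proof.
transitivity ((u^T *m (M *m v)) 0 0).
  by rewrite /dotv [RHS]mxE; apply: eq_bigr => i _; rewrite [in RHS]mxE.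
rewrite mulmxA mxE; apply: eq_bigr => i _; congr (_ * _).
by rewrite -[M in LHS]trmxK -trmx_mul mxE.
Qed.

Lemma dotv_ge0 (R : realType) p (u : 'cV[R]_p) : 0 <= dotv u u.
Proof. by apply: sumr_ge0 => i _; rewrite -expr2 sqr_ge0. Qed.

Lemma norm2_ge0 (R : realType) p (u : 'cV[R]_p) : 0 <= norm2 u.
Proof. exact: sqrtr_ge0. Qed.

Lemma norm20 (R : realType) p : norm2 (0 : 'cV[R]_p) = 0.
Proof. by rewrite /norm2 dot0v sqrtr0. Qed.

Lemma sqr_norm2 (R : realType) p (u : 'cV[R]_p) : norm2 u ^+ 2 = dotv u u.
Proof. by rewrite sqr_sqrtr// dotv_ge0. Qed.

Lemma norm2N (R : realType) p (u : 'cV[R]_p) : norm2 (- u) = norm2 u.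
Proof. by rewrite /norm2 dotvNl dotvNr opprK. Qed.

Lemma norm2Z (R : realType) p (a : R) (u : 'cV[R]_p) :
  norm2 (a *: u) = `|a| * norm2 u.
Proof.
by rewrite /norm2 dotvZl dotvZr mulrA -expr2 sqrtrM ?sqr_ge0// sqrtr_sqr.
Qed.

Lemma ler_coord_norm2 (R : realType) p (u : 'cV[R]_p) i : `|u i 0| <= norm2 u.
Proof.
rewrite -sqrtr_sqr; apply: ler_wsqrtr; rewrite /dotv (bigD1 i)//= expr2 lerDl.
by apply: sumr_ge0 => j _; rewrite -expr2 sqr_ge0.
Qed.

Lemma norm2_eq0 (R : realType) p (u : 'cV[R]_p) : norm2 u = 0 -> u = 0.
Proof.
move=> u0; apply/colP => i; rewrite mxE; apply/eqP; rewrite -normr_eq0.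
by rewrite -normr_le0 normr_id -u0; exact: ler_coord_norm2.
Qed.

Lemma cauchy_schwarz (R : realType) p (u v : 'cV[R]_p) :
  dotv u v ^+ 2 <= dotv u u * dotv v v.
Proof.
have [v0|v0] := eqVneq (dotv v v) 0.
  have -> : v = 0 by apply: norm2_eq0; rewrite /norm2 v0 sqrtr0.
  by rewrite dotvC !dot0v expr0n mulr0.
have vp : 0 < dotv v v by rewrite lt_neqAle eq_sym v0 dotv_ge0.
(* the vector is |v|^2 times the component of u orthogonal to v *)
have := dotv_ge0 (dotv v v *: u - dotv u v *: v).
rewrite !dotvE (dotvC v u).
rewrite (_ : _ + _ =
  dotv v v * (dotv u u * dotv v v - dotv u v ^+ 2)); last by ring.
by rewrite pmulr_rge0// subr_ge0.
Qed.

Lemma ler_dotv_norm2 (R : realType) p (u v : 'cV[R]_p) :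
  `|dotv u v| <= norm2 u * norm2 v.
Proof.
rewrite -sqrtrM ?dotv_ge0// -sqrtr_sqr; apply: ler_wsqrtr.
exact: cauchy_schwarz.
Qed.

(** Each entry of M v is the product of a row of M with v, so by
    Cauchy-Schwarz the Frobenius norm bounds the supremum. *)
Lemma opnorm_has_sup (R : realType) m p (M : 'M[R]_(m, p)) :
  has_sup [set norm2 (M *m v) | v in [set v : 'cV[R]_p | norm2 v <= 1]].
Proof.
split.
  by exists (norm2 (M *m 0)), 0 => //=; rewrite norm20.
exists (Num.sqrt (\sum_i norm2 (row i M)^T ^+ 2)) => _ [v /= v1 <-].
apply: ler_wsqrtr; apply: ler_sum => i _; rewrite -expr2.
have -> : (M *m v) i 0 = dotv (row i M)^T v.
  by rewrite mxE; apply: eq_bigr => j _; rewrite !mxE.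
rewrite -real_normK ?num_real//.
rewrite lerXn2r ?nnegrE ?norm2_ge0 ?normr_ge0//.
apply: (le_trans (ler_dotv_norm2 _ _)).
by rewrite -[leRHS]mulr1 ler_wpM2l// norm2_ge0.
Qed.

Lemma ler_opnorm (R : realType) m p (M : 'M[R]_(m, p)) v :
  norm2 (M *m v) <= opnorm M * norm2 v.
Proof.
have [v0|v0] := eqVneq (norm2 v) 0.
  by rewrite v0 mulr0 (norm2_eq0 v0) mulmx0 norm20.
have vp : 0 < norm2 v by rewrite lt_neqAle eq_sym v0 norm2_ge0.
rewrite -ler_pdivrMr//.
apply: (sup_upper_bound (opnorm_has_sup M)); exists ((norm2 v)^-1 *: v) => /=.
  by rewrite norm2Z ger0_norm ?invr_ge0 ?norm2_ge0// mulVf.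
by rewrite -scalemxAr norm2Z ger0_norm ?invr_ge0 ?norm2_ge0// mulrC.
Qed.

Lemma opnorm_ge0 (R : realType) m p (M : 'M[R]_(m, p)) : 0 <= opnorm M.
Proof.
apply: le_trans (sup_upper_bound (opnorm_has_sup M) _); last first.
  by exists 0 => //=; rewrite norm20.
exact: norm2_ge0.
Qed.

Lemma opnorm_gt0 (R : realType) m p (M : 'M[R]_(m, p)) : M != 0 -> 0 < opnorm M.
Proof.
rewrite lt_def opnorm_ge0 andbT; apply: contraNneq => M0.
apply/eqP/matrixP => i j; rewrite mxE.
have : norm2 (M *m delta_mx j 0) <= 0.
  by apply: le_trans (ler_opnorm _ _) _; rewrite M0 mul0r.
move/(le_trans (ler_coord_norm2 _ i)); rewrite normr_le0 => /eqP.
by rewrite -colE mxE.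
Qed.

Lemma dotv_mulmx_le (R : realType) m p (M : 'M[R]_(m, p)) v :
  dotv (M *m v) (M *m v) <= opnorm M ^+ 2 * dotv v v.
Proof.
rewrite -!sqr_norm2 -exprMn lerXn2r ?nnegrE ?mulr_ge0 ?opnorm_ge0 ?norm2_ge0//.
exact: ler_opnorm.
Qed.

(** * Minima over compact sets *)

Lemma dotvB_continuous (R : realType) p (a : 'cV[R]_p) :
  continuous (fun u : 'cV[R]_p => dotv (u - a) (u - a)).
Proof.
rewrite (_ : (fun u => _) =
    fun u : 'cV[R]_p => \sum_(i < p) (u i 0 - a i 0) * (u i 0 - a i 0)); last first.
  by apply/funext => u; apply: eq_bigr => i _; rewrite !mxE.
apply: continuous_big; first exact: add_continuous.
have ci i : continuous (fun u : 'cV[R]_p => u i 0 - a i 0).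
  by move=> u; apply: cvgB;
    [exact: (nbhs_filter u)|exact: coord_continuous|
      exact: (@cvg_cst _ _ _ _ (nbhs_filter u))].
by move=> i _ u; apply: cvgM; [exact: (nbhs_filter u)|exact: ci..].
Qed.

Lemma norm2B_continuous (R : realType) p (a : 'cV[R]_p) :
  continuous (fun u : 'cV[R]_p => norm2 (u - a)).
Proof.
move=> u; apply: (@continuous_comp _ _ _
    (fun u : 'cV[R]_p => dotv (u - a) (u - a)) (@Num.sqrt R)).
  exact: dotvB_continuous.
exact: sqrt_continuous.
Qed.

Lemma trmx_continuous (R : realType) m n :
  continuous (fun M : 'M[R]_(m, n) => M^T).
Proof.
move=> M P /nbhs_ballP[e e0 eP]; apply/nbhs_ballP; exists e => // N [_ MN].
by apply: eP; split => // i j; rewrite !mxE; exact: MN.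
Qed.

(** Transposition carries the box of row vectors of sup norm at most r to
    columns, and the Euclidean ball is a closed part of that box. *)
Lemma closed_ball2_compact (R : realType) p (a : 'cV[R]_p) (r : R) :
  compact [set u | norm2 (u - a) <= r].
Proof.
pose box := [set v : 'rV[R]_p | forall i, `[a i 0 - r, a i 0 + r]%classic (v ord0 i)].
have cbox : compact (trmx @` box).
  apply: continuous_compact; first exact/continuous_subspaceT/trmx_continuous.
  by apply: (@rV_compact R p (fun i => `[a i 0 - r, a i 0 + r]%classic)) => i;
    exact: segment_compact.
apply: (subclosed_compact _ cbox).
  have -> : [set u | norm2 (u - a) <= r]
      = (fun u => norm2 (u - a)) @^-1` [set x | x <= r] by [].
  apply: preimage_closed; last exact: closed_le.
  by move=> u _; exact: norm2B_continuous.
move=> u /= ur; exists u^T; last by rewrite trmxK.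
move=> i /=; rewrite mxE in_itv/= -ler_distlC distrC.
apply: le_trans ur; have := ler_coord_norm2 (u - a) i; by rewrite !mxE.
Qed.

(** The sets {h <= h v} with v in C are totally ordered by inclusion, hence
    generate a filter on C; a cluster point of it lies in each of them. *)
Lemma compact_min_attained (R : realType) (T : topologicalType) (C : set T)
    (h : T -> \bar R) :
  compact C -> C !=set0 -> (forall a : R, closed [set u | (h u <= a%:E)%E]) ->
  exists2 u, C u & forall v, C v -> (h u <= h v)%E.
Proof.
move=> cC [v0 Cv0] clh.
have clhE (a : \bar R) : closed [set u | (h u <= a)%E].
  case: a => [a||]; first exact: clh.
    rewrite (_ : [set u | _] = setT); first exact: closedT.
    by apply/seteqP; split => u //= _; rewrite leey.
  rewrite (_ : [set u | _] = \bigcap_(a in [set: R]) [set u | (h u <= a%:E)%E]).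
    by apply: closed_bigI.
  apply/seteqP; split => u /=.
    by move=> hu a _ /=; apply: le_trans hu _; rewrite leNye.
  move=> hu; case E : (h u) => [a||]//.
    by have := hu (a - 1) I; rewrite /= E lee_fin lerBrDr gerDl ler10.
  by have := hu 0 I; rewrite /= E.
pose D v := C `&` [set u | (h u <= h v)%E].
have PF : ProperFilter (filter_from C D).
  apply: filter_from_proper; last by move=> v Cv; exists v; split => /=.
  apply: filter_from_filter; first by exists v0.
  move=> v w Cv Cw; have [vw|/ltW wv] := leP (h v) (h w).
    by exists v => // u [Cu /= uv]; split; split => //=; exact: le_trans vw.
  by exists w => // u [Cu /= uv]; split; split => //=; exact: le_trans wv.
have [|u [Cu clu]] := cC _ PF; first by exists v0 => // u [].
exists u => // v Cv; suff : [set u | (h u <= h v)%E] u by [].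
apply: clhE => P Pu; apply: clu => //.
by exists v => // w [].
Qed.

(** * Projection onto a closed convex set *)

Lemma convex_setP (R : realType) n (K : set 'cV[R]_n) u v (t : R) :
  @convex_set R 'cV[R]_n K -> K u -> K v -> 0 <= t <= 1 ->
  K (t *: u + (1 - t) *: v).
Proof.
move=> cK Ku Kv /andP[t0 t1].
have := cK u v (Itv01 t0 t1); rewrite !inE => /(_ Ku Kv).
by rewrite /conv/=.
Qed.

(** Dividing by t and letting t tend to 0 leaves D; the optimality conditions
    for projections and for convex minimization are read off in this way. *)
Lemma ge0_of_quadratic (R : realType) (D C : R) :
  (forall t, 0 < t <= 1 -> 0 <= t * D + t ^+ 2 * C) -> 0 <= D.
Proof.
move=> H; rewrite leNgt; apply/negP => D0.
(* at this t the quadratic term outweighs at most half of the linear one *)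
pose t := Num.min 1 (- D / (2 * (`|C| + 1))).
have c0 : 0 < 2 * (`|C| + 1) by rewrite mulr_gt0// ltr_pwDr.
have t0 : 0 < t by rewrite /t lt_min ltr01 divr_gt0// oppr_gt0.
have t1 : t <= 1 by rewrite /t ge_min lexx.
have tD : t * (2 * (`|C| + 1)) <= - D by rewrite -ler_pdivlMr// /t ge_min lexx orbT.
have := H t; rewrite t0 t1 => /(_ isT).
rewrite expr2 -mulrA -mulrDr pmulr_rge0// => h.
have : t * C <= t * `|C| by rewrite ler_pM2l// ler_norm.
have : 0 <= t * `|C| by rewrite mulr_ge0// ltW.
nra.
Qed.

Lemma proj_set_spec (R : realType) n (K : set 'cV[R]_n) s :
  K !=set0 -> closed K ->
  K (proj_set K s) /\
  forall v, K v -> norm2 (s - proj_set K s) <= norm2 (s - v).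
Proof.
move=> [w Kw] cK.
suff ex : exists u, K u /\ forall v, K v -> norm2 (s - u) <= norm2 (s - v).
  exact: (xgetPex 0 ex).
have nB (u v : 'cV[R]_n) : norm2 (u - v) = norm2 (v - u).
  by rewrite -norm2N opprB.
pose C := [set u | norm2 (u - s) <= norm2 (w - s)] `&` K.
have cC : compact C.
  apply: (subclosed_compact _ (closed_ball2_compact (a := s) (r := norm2 (w - s)))).
    apply: closedI => //; apply: compact_closed; first exact: norm_hausdorff.
    exact: closed_ball2_compact.
  by move=> u [].
have [||u [us Ku] umin] := @compact_min_attained R _ C
    (fun u => (norm2 (u - s))%:E) cC.
- by exists w; split => //=.
- move=> a; rewrite (_ : [set u | _] = (fun u => norm2 (u - s)) @^-1` [set x | x <= a]).
    by apply: preimage_closed; [move=> u _; exact: norm2B_continuous|exact: closed_le].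
  by apply/seteqP; split => u /=; rewrite lee_fin.
exists u; split => // v Kv; rewrite nB (nB s).
have [vw|/ltW wv] := leP (norm2 (v - s)) (norm2 (w - s)).
  by rewrite -lee_fin; apply: umin; split.
exact: le_trans us wv.
Qed.

Lemma dist_setE (R : realType) n (K : set 'cV[R]_n) s :
  K !=set0 -> closed K -> dist_set K s = norm2 (s - proj_set K s).
Proof.
move=> K0 cK; have [Kp pmin] := proj_set_spec s K0 cK.
apply/eqP; rewrite eq_le; apply/andP; split.
  apply: ge_inf; last by exists (proj_set K s).
  by exists 0 => _ [v _ <-]; exact: norm2_ge0.
apply: lb_le_inf; first by exists (norm2 (s - proj_set K s)), (proj_set K s).
by move=> _ [v Kv <-]; exact: pmin.
Qed.

Lemma proj_set_variational (R : realType) n (K : set 'cV[R]_n) s v :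
  closed K -> @convex_set R 'cV[R]_n K -> K v ->
  dotv (s - proj_set K s) (v - proj_set K s) <= 0.
Proof.
move=> cK vK Kv.
have [Kp pmin] := proj_set_spec s (ex_intro _ v Kv) cK.
set p := proj_set K s in Kp pmin *.
rewrite -oppr_ge0 -(pmulr_rge0 _ (ltr0n R 2)).
apply: (ge0_of_quadratic (C := dotv (v - p) (v - p))) => t /andP[t0 t1].
have /pmin : K (t *: v + (1 - t) *: p).
  by apply: convex_setP => //; rewrite t1 ltW.
rewrite -(@ler_pXn2r _ 2) ?nnegrE ?norm2_ge0// !sqr_norm2.
rewrite (_ : s - (t *: v + (1 - t) *: p) = (s - p) - t *: (v - p)); last first.
  by apply/colP => i; rewrite !mxE; ring.
move: (s - p) (v - p) => a b.
by rewrite !dotvE (dotvC b a) => h; nra.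
Qed.

Lemma dist_set_ge0 (R : realType) n (K : set 'cV[R]_n) s :
  K !=set0 -> closed K -> 0 <= dist_set K s.
Proof. by move=> K0 cK; rewrite dist_setE// norm2_ge0. Qed.

Lemma dist_set_le (R : realType) n (K : set 'cV[R]_n) s v :
  closed K -> K v -> dist_set K s <= norm2 (s - v).
Proof.
move=> cK Kv; have K0 : K !=set0 by exists v.
by rewrite dist_setE//; have [_] := proj_set_spec s K0 cK; exact.
Qed.

(** With q = s - proj s, this compares dist^2 / 2 at s' with its linearisation at
    s.  The last term, which convexity alone would not give, expresses that q is
    a cocoercive gradient. *)
Lemma sqr_dist_set_ge (R : realType) n (K : set 'cV[R]_n) s s'
    (q := s - proj_set K s) (q' := s' - proj_set K s') :
  K !=set0 -> closed K -> @convex_set R 'cV[R]_n K ->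
  dotv q q / 2 + dotv q (s' - s) + dotv (q - q') (q - q') / 2 <= dotv q' q' / 2.
Proof.
move=> K0 cK vK.
have [Kp' _] := proj_set_spec s' K0 cK.
have h := proj_set_variational s cK vK Kp'.
have -> : s' - s = q' - q + (proj_set K s' - proj_set K s).
  by apply/colP => i; rewrite /q /q' !mxE; ring.
rewrite -/q in h; move: h; move: (proj_set K s' - proj_set K s) => w h.
by clearbody q q'; rewrite !dotvE in h *; rewrite (dotvC q' q); lra.
Qed.

(** * Minimization of convex functions and the proximal map *)

Lemma dom_fineK (R : realType) (T : Type) (h : T -> \bar R) u :
  proper_fun h -> dom h u -> (fine (h u))%:E = h u.
Proof. by move=> [hN _] hu; rewrite fineK// fin_numElt ltNye hN. Qed.

Lemma convex_fine (R : realType) p (h : 'cV[R]_p -> \bar R) u v t :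
  proper_fun h -> convex_fun h -> dom h u -> dom h v -> 0 <= t <= 1 ->
  dom h (t *: u + (1 - t) *: v) /\
  fine (h (t *: u + (1 - t) *: v)) <= t * fine (h u) + (1 - t) * fine (h v).
Proof.
move=> ph ch hu hv t01; have := ch u v t t01.
rewrite -(dom_fineK ph hu) -(dom_fineK ph hv) -!EFinM -EFinD /= => le.
have d : dom h (t *: u + (1 - t) *: v) by exact: le_lt_trans le (ltry _).
by split => //; rewrite -lee_fin dom_fineK.
Qed.

Lemma argmin_dom (R : realType) p (h : 'cV[R]_p -> \bar R) (phi : 'cV[R]_p -> R) u :
  proper_fun h -> argmin (fun w => h w + (phi w)%:E)%E u -> dom h u.
Proof.
move=> [_ [v hv]] /(_ v) le; rewrite /dom /= ltey.
apply/negP => /eqP hu; move: le; rewrite hu addye// leye_eq => /eqP E.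
by have := lte_add_pinfty hv (ltry (phi v)); rewrite E.
Qed.

(** The optimality condition of min (h + phi), with phi replaced by a quadratic
    upper model along the segment from the minimizer u to v: h lies below its
    chord, so the one-sided slope of the sum at u cannot be negative. *)
Lemma argmin_first_order (R : realType) p (h : 'cV[R]_p -> \bar R)
    (phi : 'cV[R]_p -> R) u v (D C : R) :
  proper_fun h -> convex_fun h -> argmin (fun w => h w + (phi w)%:E)%E u ->
  dom h v ->
  (forall t, 0 < t <= 1 ->
     phi (t *: v + (1 - t) *: u) <= phi u + t * D + t ^+ 2 * C) ->
  fine (h u) <= fine (h v) + D.
Proof.
move=> ph ch um hv phiH; have hu := argmin_dom ph um.
rewrite -subr_ge0; apply: (@ge0_of_quadratic _ _ C) => t /andP[t0 t1].
have t01 : 0 <= t <= 1 by rewrite t1 ltW.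
have [dw hw] := convex_fine ph ch hv hu t01.
have := um (t *: v + (1 - t) *: u).
rewrite -(dom_fineK ph dw) -(dom_fineK ph hu) -!EFinD lee_fin.
have := phiH t; rewrite t0 t1 => /(_ isT).
by move: hw; lra.
Qed.

Lemma closed_fun_sublevel (R : realType) p (h : 'cV[R]_p -> \bar R)
    (q : 'cV[R]_p -> R) (a : R) :
  closed_fun h -> continuous q -> closed [set u | (h u + (q u)%:E <= a%:E)%E].
Proof.
move=> ch cq.
rewrite (_ : [set u | _] = (fun u => (u, a - q u)) @^-1` epigraph h).
  have cg : continuous (fun u : 'cV[R]_p => a - q u).
    by move=> u; apply: cvgB; [exact: (nbhs_filter u)|
      exact: (@cvg_cst _ _ _ _ (nbhs_filter u))|exact: cq].
  apply: preimage_closed => // u _.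
  exact: (@cvg_pair _ _ _ _ _ _ (nbhs_filter u) (nbhs_filter u)
    (nbhs_filter (a - q u)) id _ (@cvg_id _ _) (cg u)).
by apply/seteqP; split => u; rewrite /= /epigraph/= EFinB leeBrDr.
Qed.

(** On the compact unit ball around a point of the domain a closed convex
    function attains a finite minimum; convexity along rays leaving that point
    then prevents the function from decreasing faster than linearly. *)
Lemma convex_linear_minorant (R : realType) p (h : 'cV[R]_p -> \bar R) a :
  proper_fun h -> closed_fun h -> convex_fun h -> dom h a ->
  exists m b, [/\ 0 <= b, m <= fine (h a) &
    forall u, dom h u -> m - b * norm2 (u - a) <= fine (h u)].
Proof.
move=> ph clh ch ha.
have [||u0 /= u0a umin] := @compact_min_attained R _ _ (fun u => (h u + 0%:E)%E)
    (@closed_ball2_compact R p a 1).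
- by exists a; rewrite /= subrr norm20.
- by move=> r; apply: (@closed_fun_sublevel _ _ _ (fun=> 0)) => //; exact: cst_continuous.
have u0min u : norm2 (u - a) <= 1 -> (h u0 <= h u)%E.
  by move=> /umin; rewrite !adde0.
have u0le : (h u0 <= h a)%E.
  by apply: u0min; rewrite subrr norm20.
have hu0 : dom h u0 by exact: le_lt_trans u0le ha.
have ma : fine (h u0) <= fine (h a) by rewrite -lee_fin !dom_fineK.
exists (fine (h u0)), (fine (h a) - fine (h u0)); split; rewrite ?subr_ge0//.
move=> u hu; set T := norm2 (u - a).
have T0 : 0 <= T by exact: norm2_ge0.
have [T1|T1] := leP T 1.
  have : fine (h u0) <= fine (h u) by rewrite -lee_fin !dom_fineK// u0min.
  nra.
have Tp : 0 < T by exact: lt_trans T1.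
(* the point of the unit sphere on the segment from a to u *)
have t01 : 0 <= T^-1 <= 1 by rewrite invr_ge0 T0 invf_le1// ltW.
have [dw hw] := convex_fine ph ch hu ha t01.
have wa : norm2 (T^-1 *: u + (1 - T^-1) *: a - a) <= 1.
  rewrite (_ : _ - a = T^-1 *: (u - a)); last by apply/colP => i; rewrite !mxE; ring.
  by rewrite norm2Z ger0_norm ?invr_ge0// mulVf// gt_eqF.
have : fine (h u0) <= T^-1 * fine (h u) + (1 - T^-1) * fine (h a).
  by apply: le_trans hw; rewrite -lee_fin !dom_fineK// u0min.
rewrite -(ler_pM2l Tp) mulrDr !mulrA mulrBr mulr1 !mulfV ?gt_eqF// mul1r.
nra.
Qed.

(** The proximal objective is coercive, a quadratic beating the linear minorant,
    so a minimizer may be sought in a ball. *)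
Lemma prox_argmin (R : realType) p (h : 'cV[R]_p -> \bar R) (gamma : R) v :
  proper_fun h -> closed_fun h -> convex_fun h -> 0 < gamma ->
  argmin (fun u => h u + ((2 * gamma)^-1 * norm2 (u - v) ^+ 2)%:E)%E (prox gamma h v).
Proof.
move=> ph clh ch g0; suff ex : exists u,
    argmin (fun u => h u + ((2 * gamma)^-1 * norm2 (u - v) ^+ 2)%:E)%E u.
  exact: (xgetPex 0 ex).
set mu := (2 * gamma)^-1; have mu0 : 0 < mu by rewrite invr_gt0 mulr_gt0.
have [_ [a ha]] := ph.
have [m [b [b0 ma mb]]] := convex_linear_minorant ph clh ch ha.
pose q u := mu * norm2 (u - v) ^+ 2.
pose cst := fine (h a) - m + 2 * q a.
have cst0 : 0 <= cst.
  by rewrite /cst addr_ge0 ?subr_ge0// mulr_ge0// mulr_ge0 ?sqr_ge0// ltW.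
(* beyond distance r from a the proximal objective exceeds its value at a *)
pose r := 1 + (2 / mu) * (b + cst).
have cq : continuous q.
  move=> u; apply: cvgM; [exact: (nbhs_filter u)|
    exact: (@cvg_cst _ _ _ _ (nbhs_filter u))|].
  by apply: cvgM; [exact: (nbhs_filter u)|exact: norm2B_continuous..].
have r1 : 1 <= r by rewrite lerDl; apply: mulr_ge0; [exact/divr_ge0/ltW|exact: addr_ge0].
have [||u ur umin] := @compact_min_attained R _ _ (fun u => (h u + (q u)%:E)%E)
    (@closed_ball2_compact R p a r).
- exists a; rewrite /= subrr norm20.
  by rewrite (le_trans ler01).
- by move=> x; exact: closed_fun_sublevel.
have aball : norm2 (a - a) <= r.
  by rewrite subrr norm20 (le_trans ler01).
exists u => w; have [/umin//|rw] := leP (norm2 (w - a)) r.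
apply: le_trans (umin a aball) _.
have [hw|] := pselect (dom h w); last first.
  by rewrite /dom /= ltey => /negP; rewrite negbK => /eqP ->; rewrite addye ?leey.
rewrite -(dom_fineK ph hw) -(dom_fineK ph ha) -!EFinD lee_fin -/(q w).
have hwm := mb w hw; set T := norm2 (w - a) in rw hwm.
have T1 : 1 < T by exact: le_lt_trans rw.
have qw : mu * T ^+ 2 <= 2 * q w + 2 * q a.
  rewrite /q /T !sqr_norm2 (_ : w - a = (w - v) - (a - v)); last first.
    by apply/colP => i; rewrite !mxE; ring.
  move: (w - v) (a - v) => x y.
  have := mulr_ge0 (ltW mu0) (dotv_ge0 (x + y)); rewrite !dotvE (dotvC y x).
  lra.
have : (2 / mu) * (b + cst) <= T by apply/ltW/(lt_trans _ rw); rewrite ltrDr.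
rewrite mulrAC ler_pdivrMr// => hT.
have : 2 * (b + cst) * T <= mu * T ^+ 2 by rewrite expr2; nra.
have : cst <= cst * T by apply: ler_peMr => //; exact: ltW.
move: qw hwm; rewrite /cst; lra.
Qed.

(** * One iteration of the method *)

(** The distance from s' to K is at most that to the projection of s, whose
    square is the quadratic model at s with curvature 1. *)
Lemma sqr_dist_set_le (R : realType) n (K : set 'cV[R]_n) s s'
    (q := s - proj_set K s) :
  K !=set0 -> closed K ->
  dist_set K s' ^+ 2 / 2 <=
    dotv q q / 2 + dotv q (s' - s) + dotv (s' - s) (s' - s) / 2.
Proof.
move=> K0 cK; have [Kp _] := proj_set_spec s K0 cK.
have := dist_set_le s' cK Kp.
rewrite (_ : s' - proj_set K s = q + (s' - s)); last first.
  by apply/colP => i; rewrite /q !mxE; ring.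
rewrite -(@ler_pXn2r _ 2) ?nnegrE ?norm2_ge0 ?dist_set_ge0// sqr_norm2.
by clearbody q; move: (s' - s) => d; rewrite !dotvE (dotvC d q); lra.
Qed.

Lemma cstrB (R : realType) n p1 p2 (A : 'M[R]_(n, p1)) (B : 'M[R]_(n, p2)) c
    (u x : 'cV[R]_p1) (v y : 'cV[R]_p2) :
  cstr A B c (u, v) - cstr A B c (x, y) = A *m (u - x) + B *m (v - y).
Proof.
rewrite /cstr/= !mulmxBr; move: (A *m u) (A *m x) (B *m v) (B *m y) => a b d e.
by apply/colP => i; rewrite !mxE; ring.
Qed.

(** Both subproblems are solved against the same linearisation of dist^2 / 2,
    taken at the point cstr (x, yh) reached between them: the x-step minimizes a
    function lying below its quadratic model there, and the y-step minimizes
    the linear part of that model in y plus a proximal term whose weight |B|^2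
    dominates the curvature.  Adding the two optimality conditions makes the
    linear parts telescope into dotv q (cstr (u, v) - cstr (x, yh)). *)
Lemma alternating_step (R : realType) (n p1 p2 : nat)
    (f : 'cV[R]_p1 -> \bar R) (g : 'cV[R]_p2 -> \bar R)
    (A : 'M[R]_(n, p1)) (B : 'M[R]_(n, p2)) (c : 'cV[R]_n) (K : set 'cV[R]_n)
    (rho gamma : R) (xh x u : 'cV[R]_p1) (yh y v : 'cV[R]_p2)
    (q := cstr A B c (x, yh) - proj_set K (cstr A B c (x, yh))) :
  proper_fun f -> convex_fun f ->
  proper_fun g -> closed_fun g -> convex_fun g ->
  B != 0 -> K !=set0 -> closed K -> 0 < rho ->
  argmin (fun w => f w + (rho * psi A B c K w yh
                          + gamma / 2 * norm2 (w - xh) ^+ 2)%:E)%E x ->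
  y = prox (rho * opnorm B ^+ 2)^-1 g
        (yh - (opnorm B ^+ 2)^-1 *: grad_y_psi A B c K x yh) ->
  dom f u -> dom g v ->
  [/\ dom f x, dom g y &
   fine (f x) + fine (g y) + rho * psi A B c K x y <=
   fine (f u) + fine (g v)
   + rho * (dotv q q / 2 + dotv q (cstr A B c (u, v) - cstr A B c (x, yh)))
   + gamma * dotv (x - xh) (u - x)
   + rho * opnorm B ^+ 2 * (dotv (y - yh) (v - y) + dotv (y - yh) (y - yh) / 2)].
Proof.
move=> pf cf pg clg cg B0 K0 cK rho0 xmin yE fu gv.
have L0 : 0 < opnorm B ^+ 2 by rewrite exprn_gt0// opnorm_gt0.
set L := opnorm B ^+ 2 in L0 yE *.
have rL0 : 0 < (rho * L)^-1 by rewrite invr_gt0 mulr_gt0.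
have ymin := prox_argmin (yh - L^-1 *: grad_y_psi A B c K x yh) pg clg cg rL0.
rewrite -yE in ymin.
have fx := argmin_dom pf xmin; have gy := argmin_dom pg ymin.
split => //.
have stepx : fine (f x) <= fine (f u)
    + (rho * dotv q (A *m (u - x)) + gamma * dotv (x - xh) (u - x)).
  apply: (argmin_first_order (C := rho * dotv (A *m (u - x)) (A *m (u - x)) / 2
      + gamma * dotv (u - x) (u - x) / 2) pf cf xmin fu) => t _.
  rewrite (_ : t *: u + (1 - t) *: x = x + t *: (u - x)); last first.
    by apply/colP => i; rewrite !mxE; ring.
  have hx : psi A B c K x yh = dotv q q / 2.
    by rewrite /psi dist_setE// sqr_norm2 mulrC.
  have := sqr_dist_set_le (cstr A B c (x, yh)) (cstr A B c (x + t *: (u - x), yh)) K0 cK.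
  rewrite cstrB subrr mulmx0 addr0 [x + _]addrC addrK -scalemxAr -/q.
  rewrite -(ler_pM2l rho0) hx [X in _ <= X -> _]mulrDr.
  rewrite [_ ^+ 2 / 2]mulrC -/(psi A B c K (t *: (u - x) + x) yh) => hd.
  rewrite !sqr_norm2 -[t *: (u - x) + x - xh]addrA.
  move: hd; move: (psi _ _ _ _ _ _) (A *m (u - x)) => P d.
  move: (u - x) (x - xh) => e b.
  clearbody q; rewrite !dotvE (dotvC e b).
  lra.
(* the gradient shift of the proximal centre produces the inner product with q *)
have stepy : fine (g y) <= fine (g v)
    + rho * (L * dotv (y - yh) (v - y) + dotv q (B *m (v - y))).
  apply: (argmin_first_order (C := rho * L / 2 * dotv (v - y) (v - y))
      pg cg ymin gv) => t _.
  rewrite (_ : t *: v + (1 - t) *: y = y + t *: (v - y)); last first.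
    by apply/colP => i; rewrite !mxE; ring.
  rewrite invfM invrK !sqr_norm2 dotv_mulmx.
  rewrite (_ : grad_y_psi A B c K x yh = B^T *m q)//.
  move: (B^T *m q) => G.
  have shift z : z - (yh - L^-1 *: G) = (z - yh) + L^-1 *: G.
    by apply/colP => i; rewrite !mxE; ring.
  rewrite !shift [y + _ - yh]addrAC.
  move: (v - y) (y - yh) => e b.
  rewrite !dotvE (dotvC e b) (dotvC e G) (dotvC b G).
  rewrite le_eqVlt; apply/orP; left; apply/eqP; field.
  by rewrite gt_eqF.
have smooth : rho * psi A B c K x y <= rho * (dotv q q / 2
    + dotv q (B *m (y - yh)) + dotv (B *m (y - yh)) (B *m (y - yh)) / 2).
  rewrite ler_pM2l// [psi _ _ _ _ _ _]mulrC.
  have := sqr_dist_set_le (cstr A B c (x, yh)) (cstr A B c (x, y)) K0 cK.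
  by rewrite !cstrB subrr mulmx0 add0r.
have curv : rho * dotv (B *m (y - yh)) (B *m (y - yh))
    <= rho * (L * dotv (y - yh) (y - yh)).
  by rewrite ler_pM2l//; exact: dotv_mulmx_le.
have -> : dotv q (cstr A B c (u, v) - cstr A B c (x, yh)) =
    dotv q (A *m (u - x)) + dotv q (B *m (v - y)) + dotv q (B *m (y - yh)).
  rewrite cstrB -addrA -(dotvDr (B *m _)) -mulmxDr -dotvDr.
  by congr (dotv q (_ + _ *m _)); apply/colP => i; rewrite !mxE; ring.
lra.
Qed.

(** * Decrease of the energy *)

(** The point at which the accelerated sequence is compared with a minimizer:
    w k.+1 is the average of w k, with weight k, and of this point at k.+1, with
    weight 1, while the extrapolated wh k is the same average with this point
    at k. *)
Definition lead (R : realType) p (w wh : nat -> 'cV[R]_p) (k : nat) : 'cV[R]_p :=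
  k.+1%:R *: wh k - k%:R *: w k.

Lemma lead_xh (R : realType) p (w wh : nat -> 'cV[R]_p) k :
  (k%:R + 1) *: wh k = k%:R *: w k + lead w wh k.
Proof. by apply/colP => i; rewrite !mxE -natr1; ring. Qed.

Lemma lead_x (R : realType) p (w wh : nat -> 'cV[R]_p) k :
  (forall k, wh k.+1 = w k.+1 + (k%:R / (k + 2)%:R) *: (w k.+1 - w k)) ->
  (k%:R + 1) *: w k.+1 = k%:R *: w k + lead w wh k.+1.
Proof.
move=> whE; apply/colP => i; rewrite /lead whE !mxE addn2.
rewrite -!natr1; field.
by rewrite !natr1 pnatr_eq0.
Qed.

(** The inner products of one iteration, taken with the averages of lead, are a
    difference of squared distances to the comparison point a. *)
Lemma three_point (R : realType) p (w w' wh a b b' : 'cV[R]_p) (S : R) :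
  (S + 1) *: wh = S *: w + b -> (S + 1) *: w' = S *: w + b' ->
  (S + 1) * (S * dotv (w' - wh) (w - w') + dotv (w' - wh) (a - w'))
    + (S + 1) ^+ 2 * dotv (w' - wh) (w' - wh) / 2 =
  (dotv (b - a) (b - a) - dotv (b' - a) (b' - a)) / 2.
Proof.
move=> bE b'E.
have -> : b = (S + 1) *: wh - S *: w by rewrite bE addrAC subrr add0r.
have -> : b' = (S + 1) *: w' - S *: w by rewrite b'E addrAC subrr add0r.
rewrite !dotvE (dotvC w' wh) (dotvC w wh) (dotvC a wh) (dotvC w w') (dotvC a w') (dotvC a w).
by field.
Qed.

(** At k = 0 only the distances remain, whereas at k >= 1 they may be dropped,
    leaving k times the objective gap plus rho0 / 2 times the square of
    k dist_set K. *)
Definition energy (R : realType) (n p1 p2 : nat)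
    (f : 'cV[R]_p1 -> \bar R) (g : 'cV[R]_p2 -> \bar R)
    (A : 'M[R]_(n, p1)) (B : 'M[R]_(n, p2)) (c : 'cV[R]_n) (K : set 'cV[R]_n)
    (x xh : nat -> 'cV[R]_p1) (y yh : nat -> 'cV[R]_p2) (rho0 gamma0 : R)
    (xs : 'cV[R]_p1) (ys : 'cV[R]_p2) (k : nat) : R :=
  k%:R * (fine (f (x k)) + fine (g (y k)) - (fine (f xs) + fine (g ys)))
  + k%:R ^+ 2 * rho0 * psi A B c K (x k) (y k)
  + (gamma0 * dotv (lead x xh k - xs) (lead x xh k - xs)
     + rho0 * opnorm B ^+ 2 * dotv (lead y yh k - ys) (lead y yh k - ys)) / 2.

(** The scalar content of one iteration: N times the bound at the previous
    iterate plus the bound at the minimizer, with the two cocoercivity terms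
    absorbed by the square. *)
Lemma energy_arith (R : realFieldType) (N r gam L F1 P1 F0 Fs qq qqk qkqk lk ls
    ax bx dx Vx Vx1 ay b_y dy Vy Vy1 : R) :
  0 <= N -> 0 <= r -> 0 <= gam -> 0 <= dx ->
  F1 + (N + 1) * r * P1 <= F0 + (N + 1) * r * (qq / 2 + lk)
    + (N + 1) * gam * ax + (N + 1) * r * L * (ay + dy / 2) ->
  F1 + (N + 1) * r * P1 <= Fs + (N + 1) * r * (qq / 2 + ls)
    + (N + 1) * gam * bx + (N + 1) * r * L * (b_y + dy / 2) ->
  qq / 2 + lk + (qq - 2 * qqk + qkqk) / 2 <= qkqk / 2 ->
  qq / 2 + ls + qq / 2 <= 0 ->
  0 <= (N + 1) ^+ 2 * qq - 2 * (N + 1) * N * qqk + N ^+ 2 * qkqk ->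
  (N + 1) * (N * ax + bx) + (N + 1) ^+ 2 * dx / 2 = (Vx - Vx1) / 2 ->
  (N + 1) * (N * ay + b_y) + (N + 1) ^+ 2 * dy / 2 = (Vy - Vy1) / 2 ->
  (N + 1) * (F1 - Fs) + (N + 1) ^+ 2 * r * P1 + (gam * Vx1 + r * L * Vy1) / 2
  <= N * (F0 - Fs) + N ^+ 2 * r * (qkqk / 2) + (gam * Vx + r * L * Vy) / 2.
Proof.
move=> N0 r0 g0 dx0 hk hs ck cs sq ex ey.
have N1 : 0 <= N + 1 by rewrite addr_ge0.
have {}hk := ler_wpM2l N0 hk.
have {}ck := ler_wpM2l (mulr_ge0 (mulr_ge0 r0 N1) N0) ck.
have {}cs := ler_wpM2l (mulr_ge0 r0 N1) cs.
have {}sq := mulr_ge0 r0 sq.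
have {}dx0 := mulr_ge0 (mulr_ge0 g0 (sqr_ge0 (N + 1))) dx0.
have -> : Vx1 = Vx - 2 * ((N + 1) * (N * ax + bx) + (N + 1) ^+ 2 * dx / 2).
  by rewrite ex; field.
have -> : Vy1 = Vy - 2 * ((N + 1) * (N * ay + b_y) + (N + 1) ^+ 2 * dy / 2).
  by rewrite ey; field.
clear -hk hs ck cs sq dx0.
lra.
Qed.

(** The inequality of one iteration is used at the previous iterate, with weight
    k, and at the feasible point, with weight 1.  Between iterations k and k + 1
    the penalty parameter grows, which costs k rho0 dist^2 / 2 at the previous
    iterate; the cocoercivity term of sqr_dist_set_ge pays exactly for it, by
    completing the square |(k + 1) q - k q'|^2. *)
Lemma energy_decreasing (R : realType) (n p1 p2 : nat)
    (f : 'cV[R]_p1 -> \bar R) (g : 'cV[R]_p2 -> \bar R)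
    (A : 'M[R]_(n, p1)) (B : 'M[R]_(n, p2)) (c : 'cV[R]_n) (K : set 'cV[R]_n)
    (x : nat -> 'cV[R]_p1) (y : nat -> 'cV[R]_p2)
    (xh : nat -> 'cV[R]_p1) (yh : nat -> 'cV[R]_p2) (rho gamma : nat -> R)
    (xs : 'cV[R]_p1) (ys : 'cV[R]_p2) (k : nat)
    (E := energy f g A B c K x xh y yh (rho 0%N) (gamma 0%N) xs ys) :
  proper_fun f -> convex_fun f ->
  proper_fun g -> closed_fun g -> convex_fun g ->
  B != 0 -> closed K -> @convex_set R 'cV[R]_n K ->
  algorithm1 f g A B c K x y xh yh rho gamma ->
  dom f xs -> dom g ys -> K (cstr A B c (xs, ys)) ->
  dom f (x k) -> dom g (y k) ->
  [/\ dom f (x k.+1), dom g (y k.+1) & E k.+1 <= E k].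
Proof.
move=> pf cf pg clg cg B0 cK vK alg fs gs Ks fk gk.
have K0 : K !=set0 by exists (cstr A B c (xs, ys)).
have rho0 := alg_rho0 alg; have gamma0 := alg_gamma0 alg.
have rhoE : rho k = (k%:R + 1) * rho 0%N.
  case: (k) => [|j]; first by rewrite add0r mul1r.
  by rewrite (alg_rho alg) addn2 natr1.
have gammaE : gamma k = (k%:R + 1) * gamma 0%N.
  case: (k) => [|j]; first by rewrite add0r mul1r.
  by rewrite (alg_gamma alg) addn2 natr1 mulrC.
have T0 : 0 < k%:R + 1 :> R by rewrite natr1 ltr0n.
have rk : 0 < rho k by rewrite rhoE mulr_gt0.
have [fk1 gk1 hk] := alternating_step pf cf pg clg cg B0 K0 cK rk
  (alg_x alg k) (alg_y alg k) fk gk.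
have [_ _ hs] := alternating_step pf cf pg clg cg B0 K0 cK rk
  (alg_x alg k) (alg_y alg k) fs gs.
split => //.
move: hk hs; rewrite rhoE gammaE.
set s := cstr A B c (x k.+1, yh k); set q := s - proj_set K s.
have := sqr_dist_set_ge s (cstr A B c (x k, y k)) K0 cK vK.
have := sqr_dist_set_ge s (cstr A B c (xs, ys)) K0 cK vK.
have q0 : cstr A B c (xs, ys) - proj_set K (cstr A B c (xs, ys)) = 0.
  apply: norm2_eq0; apply/eqP; rewrite eq_le norm2_ge0 andbT -dist_setE//.
  by rewrite (le_trans (dist_set_le _ cK Ks))// subrr norm20.
rewrite q0 subr0 -/q.
set qk := cstr A B c (x k, y k) - proj_set K _.
have psik : psi A B c K (x k) (y k) = dotv qk qk / 2.
  by rewrite /psi dist_setE// sqr_norm2 mulrC.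
have sq := dotv_ge0 ((k%:R + 1) *: q - k%:R *: qk).
have ex := three_point xs (lead_xh x xh k) (lead_x k (alg_xh alg)).
have ey := three_point ys (lead_xh y yh k) (lead_x k (alg_yh alg)).
rewrite /E /energy psik -[k.+1%:R]natr1 dot0v mul0r => cocs cock hk hs.
have qqk : dotv (q - qk) (q - qk) = dotv q q - 2 * dotv q qk + dotv qk qk.
  by clearbody q qk; rewrite !dotvE (dotvC qk q); ring.
rewrite qqk in cock.
have sqE : dotv ((k%:R + 1) *: q - k%:R *: qk) ((k%:R + 1) *: q - k%:R *: qk) =
    (k%:R + 1) ^+ 2 * dotv q q - 2 * (k%:R + 1) * k%:R * dotv q qk
    + k%:R ^+ 2 * dotv qk qk.
  by clearbody q qk; rewrite !dotvE (dotvC qk q); ring.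
rewrite sqE in sq.
exact: (energy_arith (ler0n R k) (ltW rho0) gamma0 (dotv_ge0 _)
  hk hs cock cocs sq ex ey).
Qed.

(** * Saddle points *)

(** Maximality over all multipliers forces r = cstr (x, y), so the coupling term
    vanishes at the saddle point and the remaining inequality compares values of
    the objective. *)
Lemma saddle_point_spec (R : realType) (n p1 p2 : nat)
    (f : 'cV[R]_p1 -> \bar R) (g : 'cV[R]_p2 -> \bar R)
    (A : 'M[R]_(n, p1)) (B : 'M[R]_(n, p2)) (c : 'cV[R]_n) (K : set 'cV[R]_n)
    (xs : 'cV[R]_p1) (ys : 'cV[R]_p2) (rs lams : 'cV[R]_n) :
  proper_fun f -> proper_fun g -> saddle_point f g A B c K xs ys rs lams ->
  [/\ dom f xs, dom g ys, K (cstr A B c (xs, ys)) &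
    forall u v r, dom f u -> dom g v -> K r ->
      fine (f xs) + fine (g ys) <=
      fine (f u) + fine (g v) - dotv (cstr A B c (u, v) - r) lams].
Proof.
move=> pf pg [fs gs Kr sad].
have lagE u v r lam : dom f u -> dom g v ->
    lagrangian f g A B c u v r lam =
    (fine (f u) + fine (g v) - dotv (cstr A B c (u, v) - r) lam)%:E.
  move=> fu gv; rewrite /lagrangian -(dom_fineK pf fu) -(dom_fineK pg gv).
  by rewrite [A *m u + _ - r - c]addrAC.
have resid : cstr A B c (xs, ys) - rs = 0.
  (* test the maximality of lams against lams - d, d the residual itself *)
  set d := _ - rs.
  have [+ _] := sad xs ys rs (lams - d) fs gs Kr.
  rewrite !lagE// lee_fin -/d; clearbody d; rewrite !dotvE => le.
  apply: norm2_eq0; apply/eqP; rewrite /norm2 sqrtr_eq0; lra.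
have Ks : K (cstr A B c (xs, ys)) by move/eqP: resid; rewrite subr_eq0 => /eqP ->.
split => // u v r fu gv Kr'.
have [_] := sad u v r lams fu gv Kr'.
by rewrite !lagE// lee_fin resid dot0v subr0.
Qed.

(** In particular every saddle point is feasible and has the same objective
    value, so that the primal point and the multiplier of the rates may come
    from different saddle points. *)
Lemma saddle_point_optval (R : realType) (n p1 p2 : nat)
    (f : 'cV[R]_p1 -> \bar R) (g : 'cV[R]_p2 -> \bar R)
    (A : 'M[R]_(n, p1)) (B : 'M[R]_(n, p2)) (c : 'cV[R]_n) (K : set 'cV[R]_n)
    (xs : 'cV[R]_p1) (ys : 'cV[R]_p2) (rs lams : 'cV[R]_n) :
  proper_fun f -> proper_fun g -> saddle_point f g A B c K xs ys rs lams ->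
  optval f g A B c K = (fine (f xs) + fine (g ys))%:E.
Proof.
move=> pf pg sad; have [fs gs Ks low] := saddle_point_spec pf pg sad.
apply/eqP; rewrite eq_le; apply/andP; split.
  apply: ereal_inf_lbound; exists (xs, ys) => //.
  by rewrite /objective/= EFinD !dom_fineK.
apply: le_ereal_inf_tmp => _ [[u v] /= Kuv <-]; rewrite /objective/=.
have [fu|fu] := pselect (dom f u); last first.
  move/negP: fu; rewrite ltey negbK => /eqP ->.
  by rewrite addye ?leey//; case: pg => + _; exact.
have [gv|gv] := pselect (dom g v); last first.
  move/negP: gv; rewrite ltey negbK => /eqP ->.
  by rewrite addey ?leey//; case: pf => + _; exact.
rewrite -(dom_fineK pf fu) -(dom_fineK pg gv) -EFinD lee_fin.
have := low u v _ fu gv Kuv.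
by rewrite subrr dot0v subr0.
Qed.

(** * Convergence rates *)

(** The energy bound is a quadratic inequality for e = r k d, namely
    e^2 - 2 l e <= r Rp, and l + sqrt (l^2 + r Rp) is its larger root. *)
Lemma rate_arith (R : realType) (G d l r k Rp : R) :
  0 < r -> 0 < k -> 0 <= l -> 0 <= d ->
  k * G + k ^+ 2 * r * (2^-1 * d ^+ 2) <= Rp / 2 -> - (l * d) <= G ->
  let rd := l + Num.sqrt (l ^+ 2 + r * Rp) in
  `|G| <= Num.max (r * Rp) (2 * l * rd) / (2 * r * k) /\ d <= rd / (r * k).
Proof.
move=> r0 k0 l0 d0 up low rd.
have rk0 : 0 < r * k by exact: mulr_gt0.
have edr : d * (r * k) <= rd.
  rewrite /rd -lerBlDl; apply: le_trans (ler_norm _) _.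
  rewrite -sqrtr_sqr; apply: ler_wsqrtr.
  have := ler_wpM2l (ltW rk0) low.
  have := ler_wpM2l (ltW r0) up.
  lra.
have dle : d <= rd / (r * k) by rewrite ler_pdivlMr.
split=> //; rewrite ler_norml; apply/andP; split.
  apply: le_trans low; rewrite lerN2 ler_pdivlMr -?mulrA ?mulr_gt0//.
  rewrite le_max; apply/orP; right.
  have := ler_wpM2l l0 edr; lra.
rewrite ler_pdivlMr -?mulrA ?mulr_gt0// le_max; apply/orP; left.
have h : 0 <= r * (k ^+ 2 * r * (2^-1 * d ^+ 2)).
  by rewrite !mulr_ge0 ?invr_ge0 ?sqr_ge0// ltW.
have := ler_wpM2l (ltW r0) up; move: h; lra.
Qed.

Lemma bigO_inv_nat (R : realType) (h : nat -> R) (C : R) :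
  (forall k, (1 <= k)%N -> `|h k| <= C / k%:R) ->
  h =O_\oo (fun k : nat => k%:R^-1 : R).
Proof.
move=> hC; apply/eqO_exP; exists (`|C| + 1); first by rewrite ltr_wpDl.
exists 1%N => // k /= k1; apply: le_trans (hC k k1) _.
rewrite [`|_^-1|]ger0_norm// ler_wpM2r//.
by apply: le_trans (ler_norm _) _; rewrite lerDl.
Qed.

(** The upper bound on the gap is the energy bound; the lower bound takes
    r = proj_set K (cstr z) in the saddle inequality, so that the multiplier is
    paired with a vector of length dist_set K (cstr z). *)
Lemma run_rates (R : realType) (n p1 p2 : nat)
    (f : 'cV[R]_p1 -> \bar R) (g : 'cV[R]_p2 -> \bar R)
    (A : 'M[R]_(n, p1)) (B : 'M[R]_(n, p2)) (c : 'cV[R]_n) (K : set 'cV[R]_n)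
    (x : nat -> 'cV[R]_p1) (y : nat -> 'cV[R]_p2)
    (xh : nat -> 'cV[R]_p1) (yh : nat -> 'cV[R]_p2) (rho gamma : nat -> R)
    (xs : 'cV[R]_p1) (ys : 'cV[R]_p2) (lams : 'cV[R]_n)
    (rho0 := rho 0%N)
    (rp2 := Rp2 B rho0 (gamma 0%N) (x 0%N) xs (y 0%N) ys)
    (rd := Rd rho0 rp2 lams) (k : nat) :
  proper_fun f -> convex_fun f ->
  proper_fun g -> closed_fun g -> convex_fun g ->
  B != 0 -> closed K -> @convex_set R 'cV[R]_n K ->
  algorithm1 f g A B c K x y xh yh rho gamma ->
  Zstar f g A B c K (xs, ys) -> Lambdastar f g A B c K lams -> (1 <= k)%N ->
  (`|objective f g (x k, y k) - optval f g A B c K|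
     <= (Num.max (rho0 * rp2) (2 * norm2 lams * rd) / (2 * rho0 * k%:R))%:E)%E
  /\ dist_set K (cstr A B c (x k, y k)) <= rd / (rho0 * k%:R).
Proof.
move=> pf cf pg clg cg B0 cK vK alg [rs [lam0 sad]] [xl [yl [rl sadl]]] k1.
have [fs gs Ks _] := saddle_point_spec pf pg sad.
have [_ _ _ low] := saddle_point_spec pf pg sadl.
have opt := saddle_point_optval pf pg sad.
have optl := saddle_point_optval pf pg sadl.
have K0 : K !=set0 by exists (cstr A B c (xs, ys)).
pose E := energy f g A B c K x xh y yh rho0 (gamma 0%N) xs ys.
have [fk gk Ek] : [/\ dom f (x k), dom g (y k) & E k <= E 0%N].
  elim: k {k1} => [|j [fj gj Ej]].
    by split; [exact: alg_x0 alg|exact: alg_y0 alg|].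
  have [fj1 gj1 Ej1] :=
    energy_decreasing pf cf pg clg cg B0 cK vK alg fs gs Ks fj gj.
  by split => //; exact: le_trans Ej1 Ej.
have E0 : E 0%N = rp2 / 2.
  rewrite /E /energy /lead /rp2 /Rp2 (alg_xh0 alg) (alg_yh0 alg) !sqr_norm2.
  by rewrite !scale0r !subr0 !scale1r expr0n !mul0r !add0r.
rewrite opt /objective/= -(dom_fineK pf fk) -(dom_fineK pg gk) -!EFinD.
rewrite abse_EFin lee_fin.
apply: rate_arith => //; first exact: alg_rho0 alg.
- by rewrite ltr0n.
- exact: norm2_ge0.
- exact: dist_set_ge0.
- move: Ek; rewrite E0; apply: le_trans; rewrite /E /energy lerDl.
  rewrite divr_ge0// addr_ge0// !mulr_ge0 ?dotv_ge0 ?opnorm_ge0//.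
    exact: alg_gamma0 alg.
  exact/ltW/(alg_rho0 alg).
- have [Kp _] := proj_set_spec (cstr A B c (x k, y k)) K0 cK.
  have := low (x k) (y k) _ fk gk Kp.
  have -> : fine (f xl) + fine (g yl) = fine (f xs) + fine (g ys).
    by apply: EFin_inj; rewrite -opt -optl.
  rewrite dist_setE//; move: (_ - proj_set _ _) => q.
  have := ler_dotv_norm2 q lams; rewrite ler_norml => /andP[].
  lra.
Qed.

Theorem theorem1 (R : realType) (n p1 p2 : nat)
    (f : 'cV[R]_p1 -> \bar R) (g : 'cV[R]_p2 -> \bar R)
    (A : 'M[R]_(n, p1)) (B : 'M[R]_(n, p2)) (c : 'cV[R]_n) (K : set 'cV[R]_n)
    (f_proper : proper_fun f) (f_closed : closed_fun f) (f_convex : convex_fun f)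
    (g_proper : proper_fun g) (g_closed : closed_fun g) (g_convex : convex_fun g)
    (B_neq0 : B != 0)
    (K_nonempty : K !=set0) (K_closed : closed K)
    (K_convex : @convex_set R 'cV[R]_n K)
    (saddle_nonempty : exists xs ys rs lams,
      saddle_point f g A B c K xs ys rs lams)
    (optval_finite : optval f g A B c K \is a fin_num)
    (optval_attained : exists zs, [/\ Zstar f g A B c K zs,
      feasible A B c K zs & objective f g zs = optval f g A B c K])
    (x : nat -> 'cV[R]_p1) (y : nat -> 'cV[R]_p2)
    (xh : nat -> 'cV[R]_p1) (yh : nat -> 'cV[R]_p2) (rho gamma : nat -> R)
    (alg : algorithm1 f g A B c K x y xh yh rho gamma) :
  [/\ forall (xs : 'cV[R]_p1) (ys : 'cV[R]_p2) (lams : 'cV[R]_n),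
        Zstar f g A B c K (xs, ys) -> Lambdastar f g A B c K lams ->
        let rho0 := rho 0%N in
        let rp2 := Rp2 B rho0 (gamma 0%N) (x 0%N) xs (y 0%N) ys in
        let rd := Rd rho0 rp2 lams in
        forall k : nat, (1 <= k)%N ->
          (`|objective f g (x k, y k) - optval f g A B c K|
             <= (Num.max (rho0 * rp2) (2 * norm2 lams * rd)
                 / (2 * rho0 * k%:R))%:E)%E
          /\ dist_set K (cstr A B c (x k, y k)) <= rd / (rho0 * k%:R),
      (fun k : nat => fine `|objective f g (x k, y k) - optval f g A B c K|%E)
        =O_\oo (fun k : nat => k%:R^-1 : R)
    & (fun k : nat => dist_set K (cstr A B c (x k, y k)))
        =O_\oo (fun k : nat => k%:R^-1 : R)].
Proof.
have rates xs ys lams Zs Ls k k1 := @run_rates R n p1 p2 f g A B c K x y xh yh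
  rho gamma xs ys lams k f_proper f_convex g_proper g_closed g_convex B_neq0
  K_closed K_convex alg Zs Ls k1.
have [xs [ys [rs [lams sad]]]] := saddle_nonempty.
have Zs : Zstar f g A B c K (xs, ys) by exists rs, lams.
have Ls : Lambdastar f g A B c K lams by exists xs, ys, rs.
split; first by move=> *; exact: rates.
  pose M := Num.max (rho 0%N * Rp2 B (rho 0%N) (gamma 0%N) (x 0%N) xs (y 0%N) ys)
    (2 * norm2 lams * Rd (rho 0%N) (Rp2 B (rho 0%N) (gamma 0%N) (x 0%N) xs (y 0%N) ys) lams).
  apply: (@bigO_inv_nat _ _ (M / (2 * rho 0%N))) => k k1.
  have [+ _] := rates _ _ _ Zs Ls k k1; rewrite -/M invfM mulrA.
  case: (`|_|%E) (abse_ge0 (objective f g (x k, y k) - optval f g A B c K)) => [r||]//=.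
  by rewrite !lee_fin => r0; rewrite ger0_norm.
apply: (@bigO_inv_nat _ _ (Rd (rho 0%N)
  (Rp2 B (rho 0%N) (gamma 0%N) (x 0%N) xs (y 0%N) ys) lams / rho 0%N)) => k k1.
have [_] := rates _ _ _ Zs Ls k k1.
by rewrite ger0_norm ?dist_set_ge0// invfM mulrA.
Qed.
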